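(* For $n\ge 0$ let $$Q_n=\sum_{\sigma\in\mathfrak S^{\rm ca}_{2n}} x_{\rm e}^{\mathrm{eareccpeakeven}(\sigma)}\,y_{\rm e}^{\mathrm{ereccvaleven}(\sigma)}\,u_{\rm e}^{\mathrm{nrcpeakeven}(\sigma)}\,v_{\rm e}^{\mathrm{nrcvaleven}(\sigma)}\,x_{\rm o}^{\mathrm{eareccpeakodd}(\sigma)}\,y_{\rm o}^{\mathrm{ereccvalodd}(\sigma)}\,u_{\rm o}^{\mathrm{nrcpeakodd}(\sigma)}\,v_{\rm o}^{\mathrm{nrcvalodd}(\sigma)},$$ where $x_{\rm e},y_{\rm e},u_{\rm e},v_{\rm e},x_{\rm o},y_{\rm o},u_{\rm o},v_{\rm o}$ are indeterminates. Then, as formal power series in $t$, $$\sum_{n=0}^\infty Q_n\,t^n=\cfrac{1}{1-\cfrac{\alpha_1 t}{1-\cfrac{\alpha_2 t}{1-\cdots}}}$$ with, for all $k\ge1$, $\alpha_{2k-1}=[x_{\rm e}+(2k-2)u_{\rm e}]\,[y_{\rm o}+(2k-2)v_{\rm o}]$ and $\alpha_{2k}=[x_{\rm o}+(2k-1)u_{\rm o}]\,[y_{\rm e}+(2k-1)v_{\rm e}]$.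
   Context: For a permutation $\sigma$ of $[N]=\{1,\dots,N\}$, an index $i$ is a cycle peak if $\sigma^{-1}(i)<i>\sigma(i)$, a cycle valley if $\sigma^{-1}(i)>i<\sigma(i)$, a cycle double rise if $\sigma^{-1}(i)<i<\sigma(i)$, a cycle double fall if $\sigma^{-1}(i)>i>\sigma(i)$, and a fixed point if $\sigma(i)=i$. A permutation is cycle-alternating if it has no cycle double rises, cycle double falls or fixed points (so every index is a cycle peak or a cycle valley). $\mathfrak S^{\rm ca}_{2n}$ is the set of cycle-alternating permutations of $[2n]$ ($\mathfrak S^{\rm ca}_0$ consists of the empty permutation). An index $i$ is a record if $\sigma(j)<\sigma(i)$ for all $j<i$, and an antirecord if $\sigma(j)>\sigma(i)$ for all $j>i$; it is an exclusive record if it is a record but not an antirecord, an exclusive antirecord if it is an antirecord but not a record, and a neither-record-antirecord if it is neither. $\mathrm{eareccpeakeven}(\sigma)$ is the number of even indices that are cycle peaks and exclusive antirecords; $\mathrm{ereccvaleven}(\sigma)$ the number of even indices that are cycle valleys and exclusive records; $\mathrm{nrcpeakeven}(\sigma)$ the number of even indices that are cycle peaks and neither-record-antirecords; $\mathrm{nrcvaleven}(\sigma)$ the number of even indices that are cycle valleys and neither-record-antirecords; the statistics with suffix ''odd'' are defined in the same way with odd indices. *)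

(* Defs.v *)
From HB Require Import structures.
From mathcomp Require Import all_boot all_order all_fingroup all_algebra.
From mathcomp Require Export mpoly.

Set Implicit Arguments.
Unset Strict Implicit.
Unset Printing Implicit Defensive.

Import GRing.Theory.

(* A permutation of [N] = {1, .., N} is a permutation of 'I_N; the element
   i : 'I_N stands for the index i.+1.  Comparisons of indices are unaffected
   by this shift, but parities are: see [even_index]. *)
Section Permutations.
Variables (N : nat) (s : {perm 'I_N}).
Implicit Types i j : 'I_N.
Local Open Scope nat_scope.

Definition cycle_peak i := ((s^-1)%g i < i) && (s i < i).
Definition cycle_valley i := (i < (s^-1)%g i) && (i < s i).
Definition cycle_double_rise i := ((s^-1)%g i < i) && (i < s i).
Definition cycle_double_fall i := (i < (s^-1)%g i) && (s i < i).
Definition fixed_point i := s i == i.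

Definition cycle_alternating :=
  [forall i, [&& ~~ cycle_double_rise i, ~~ cycle_double_fall i
               & ~~ fixed_point i]].

Definition is_record i := [forall j : 'I_N, (j < i) ==> (s j < s i)].
Definition antirecord i := [forall j : 'I_N, (i < j) ==> (s i < s j)].
Definition exclusive_record i := is_record i && ~~ antirecord i.
Definition exclusive_antirecord i := antirecord i && ~~ is_record i.
Definition neither_record_antirecord i := ~~ is_record i && ~~ antirecord i.

Definition even_index i := ~~ odd i.+1.
Definition odd_index i := odd i.+1.

Definition eareccpeakeven :=
  #|[set i | [&& even_index i, cycle_peak i & exclusive_antirecord i]]|.
Definition ereccvaleven :=
  #|[set i | [&& even_index i, cycle_valley i & exclusive_record i]]|.
Definition nrcpeakeven :=
  #|[set i | [&& even_index i, cycle_peak i & neither_record_antirecord i]]|.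
Definition nrcvaleven :=
  #|[set i | [&& even_index i, cycle_valley i & neither_record_antirecord i]]|.
Definition eareccpeakodd :=
  #|[set i | [&& odd_index i, cycle_peak i & exclusive_antirecord i]]|.
Definition ereccvalodd :=
  #|[set i | [&& odd_index i, cycle_valley i & exclusive_record i]]|.
Definition nrcpeakodd :=
  #|[set i | [&& odd_index i, cycle_peak i & neither_record_antirecord i]]|.
Definition nrcvalodd :=
  #|[set i | [&& odd_index i, cycle_valley i & neither_record_antirecord i]]|.

End Permutations.

Local Open Scope ring_scope.

Notation polyring := {mpoly int[8]}.

Definition x_e : polyring := 'X_(@Ordinal 8 0 isT).
Definition y_e : polyring := 'X_(@Ordinal 8 1 isT).
Definition u_e : polyring := 'X_(@Ordinal 8 2 isT).
Definition v_e : polyring := 'X_(@Ordinal 8 3 isT).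
Definition x_o : polyring := 'X_(@Ordinal 8 4 isT).
Definition y_o : polyring := 'X_(@Ordinal 8 5 isT).
Definition u_o : polyring := 'X_(@Ordinal 8 6 isT).
Definition v_o : polyring := 'X_(@Ordinal 8 7 isT).

Definition Q (n : nat) : polyring :=
  \sum_(s : 'S_(2 * n) | cycle_alternating s)
    x_e ^+ eareccpeakeven s * y_e ^+ ereccvaleven s
    * u_e ^+ nrcpeakeven s * v_e ^+ nrcvaleven s
    * x_o ^+ eareccpeakodd s * y_o ^+ ereccvalodd s
    * u_o ^+ nrcpeakodd s * v_o ^+ nrcvalodd s.

(* Formal power series in t, given by their coefficients: f n is the
   coefficient of t^n. *)
Definition fps (R : Type) := nat -> R.

Section FPS.
Variable R : comNzRingType.
Implicit Types f g : fps R.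

Definition fps1 : fps R := fun n => (n == 0%N)%:R.
Definition fps_sub f g : fps R := fun n => f n - g n.
Definition fps_mul f g : fps R := fun n => \sum_(i < n.+1) f i * g (n - i)%N.
(* c t *)
Definition fps_ct (c : R) : fps R := fun n => if n == 1%N then c else 0.

(* The inverse of a series f with constant term 1 (see [fps_mulfV]), as the
   geometric series \sum_k (1 - f)^k; only the terms with k <= n contribute
   to t^n.  For other f the value is irrelevant. *)
Definition fps_inv f : fps R :=
  fun n => \sum_(k < n.+1) iter k (fps_mul (fps_sub fps1 f)) fps1 n.

Lemma fps_mulfV f : f 0%N = 1 -> fps_mul f (fps_inv f) =1 fps1.
Proof.
move=> f0 n; set h := fps_sub fps1 f.
have h0 : h 0%N = 0 by rewrite /h /fps_sub /fps1 f0 subrr.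
pose p k := iter k (fps_mul h) fps1.
have p0 k m : (m < k)%N -> p k m = 0.
  elim: k m => // k IHk m ltmk; rewrite /p iterS /fps_mul big1 // => i _.
  case: i => [[|i] lti] /=; first by rewrite h0 mul0r.
  rewrite -/(p k) IHk ?mulr0 //.
  by case: m lti ltmk => // m _ ltmk; rewrite subSS (leq_ltn_trans (leq_subr _ _)).
have invE K m : (m <= K)%N -> fps_inv f m = \sum_(k < K.+1) p k m.
  move=> lemK; rewrite /fps_inv -/h -(big_mkord xpredT (fun k => p k m)).
  rewrite -(big_mkord xpredT (fun k => p k m)) (@big_cat_nat _ _ _ m.+1 0 K.+1) //=.
  rewrite [X in _ + X]big_nat_cond [X in _ + X]big1 ?addr0 // => k.
  by rewrite andbT => /andP[ltmk _]; apply: p0.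
have hE : fps_mul h (fps_inv f) n = \sum_(k < n.+1) p k.+1 n.
  rewrite /fps_mul; under eq_bigr => i _.
    rewrite (@invE n) ?leq_subr // mulr_sumr; over.
  by rewrite exchange_big.
have -> : fps_mul f (fps_inv f) n = fps_inv f n - fps_mul h (fps_inv f) n.
  have -> : fps_inv f n = fps_mul fps1 (fps_inv f) n.
    rewrite /fps_mul big_ord_recl /= mul1r subn0 big1 ?addr0 // => i _.
    by rewrite /fps1 /= mul0r.
  rewrite /fps_mul -sumrB; apply: eq_bigr => i _.
  by rewrite /h /fps_sub -mulrBl opprB addrC subrK.
rewrite hE (@invE n) // big_ord_recl [X in _ - X]big_ord_recr.
rewrite [p (@ord_max n).+1 n](p0 n.+1) // Monoid.mulm1.
by rewrite addrK.
Qed.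

(* The finite continued fraction
     1 / (1 - a_k t / (1 - a_{k+1} t / ( ... / (1 - a_{k+m-1} t)))). *)
Fixpoint Sfraction_conv (a : nat -> R) (k m : nat) : fps R :=
  if m is m'.+1 then
    fps_inv (fps_sub fps1 (fps_mul (fps_ct (a k)) (Sfraction_conv a k.+1 m')))
  else fps1.

(* Convergence for the t-adic topology: every coefficient is eventually
   constant. *)
Definition fps_cvg (F : nat -> fps R) (f : fps R) : Prop :=
  forall n, exists M, forall m, (M <= m)%N -> F m n = f n.

(* f = 1 / (1 - a_1 t / (1 - a_2 t / (1 - ...))); a_0 is not used. *)
Definition Sfraction_eq (f : fps R) (a : nat -> R) : Prop :=
  fps_cvg (Sfraction_conv a 1) f.

End FPS.

(* Main.v *)
Require Import Defs.
From mathcomp Require Import all_boot all_order all_fingroup all_algebra.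

Set Implicit Arguments.
Unset Strict Implicit.
Unset Printing Implicit Defensive.

Import GRing.Theory.
Local Open Scope ring_scope.

(* A cycle-alternating permutation maps valleys to larger peaks and peaks to
   smaller valleys.  Fix the set of valleys, read as a Dyck word (valleys are up
   steps), and choose the images of the peaks from left to right, then those of
   the valleys from right to left.  A peak met at height h has h free valleys
   below it, and it is an antirecord exactly when it takes the smallest one; a
   valley met at height h has h free peaks above it, and it is a record exactly
   when it takes the largest one.  Hence the permutations with a given Dyck word
   contribute the product of weights x + (h - 1) u and y + (h - 1) v, the parity
   of an index being determined by the height, and Flajolet's theorem turns the
   sum over Dyck paths into the S-fraction. *)

(** * Dyck paths and S-fractions *)

Section FPSTheory.
Variable R : comNzRingType.
Implicit Types (f g : fps R) (a X Y : nat -> R).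

Lemma eq_fps_mul f f' g g' :
  f =1 f' -> g =1 g' -> fps_mul f g =1 fps_mul f' g'.
Proof. by move=> ef eg n; apply: eq_bigr => i _; rewrite ef eg. Qed.

(** Truncation to polynomials carries commutativity and associativity over from the polynomial
    ring. *)
Lemma fps_mul_poly N f g n : (n < N)%N ->
  fps_mul f g n = (\poly_(i < N) f i * \poly_(i < N) g i)`_n.
Proof.
move=> ltnN; rewrite coefM; apply: eq_bigr => i _.
by rewrite !coef_poly (leq_ltn_trans (leq_subr _ _) ltnN) (leq_trans (ltn_ord i)).
Qed.

Lemma fps_mulC f g : fps_mul f g =1 fps_mul g f.
Proof. by move=> n; rewrite !(@fps_mul_poly n.+1) // mulrC. Qed.

Lemma fps_mulA f g h : fps_mul f (fps_mul g h) =1 fps_mul (fps_mul f g) h.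
Proof.
move=> n; pose p k := \poly_(i < n.+1) (k i) : {poly R}.
transitivity (p f * (p g * p h))`_n.
  rewrite coefM; apply: eq_bigr => i _.
  by rewrite coef_poly ltn_ord (@fps_mul_poly n.+1) // ltnS leq_subr.
rewrite mulrA coefM; apply: eq_bigr => i _.
by rewrite coef_poly ltnS leq_subr (@fps_mul_poly n.+1).
Qed.

Lemma fps_mul1 f : fps_mul f (fps1 R) =1 f.
Proof.
move=> n; rewrite fps_mulC /fps_mul big_ord_recl /= mul1r subn0.
by rewrite big1 ?addr0 // => i _; rewrite /fps1 mul0r.
Qed.

Lemma fps_ct_mul c f n :
  fps_mul (fps_ct c) f n = if n is m.+1 then c * f m else 0.
Proof.
case: n => [|n]; first by rewrite /fps_mul big_ord1 mul0r.
rewrite /fps_mul !big_ord_recl /= mul0r add0r subSS subn0.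
by rewrite big1 ?addr0 // => i _; rewrite /fps_ct mul0r.
Qed.

(** With [F] and [F'] the two convergents, this rearranges F (1 - a_k t F') = 1. *)
Lemma Sfraction_conv_rec a k m :
  Sfraction_conv a k m.+1 =1 fun n => fps1 R n +
    fps_mul (fps_mul (fps_ct (a k)) (Sfraction_conv a k.+1 m))
            (Sfraction_conv a k m.+1) n.
Proof.
move=> n /=; set g := fps_mul (fps_ct _) _.
have g0 : fps_sub (fps1 R) g 0%N = 1 by rewrite /fps_sub /g fps_ct_mul subr0.
have {1}<- := fps_mulfV g0 n; set F := fps_inv _.
rewrite -[LHS](fps_mul1 F) (fps_mulC F) /fps_mul -big_split /=.
by apply: eq_bigr => i _; rewrite -mulrDl subrK.
Qed.

Lemma Sfraction_conv0 a k m : Sfraction_conv a k m 0%N = 1.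
Proof.
case: m => // m; rewrite Sfraction_conv_rec -(fps_mulA _ _ _ 0%N).
by rewrite fps_ct_mul addr0.
Qed.

(* Generating function of the Dyck paths of height at most [M] running from
   height [h] to 0, without the weights of the [h] unmatched down steps: split
   the path at its last visits to the heights h, h - 1, .., 0. *)
Fixpoint descents a M h : fps R :=
  if h is h'.+1 then fps_mul (descents a M h') (Sfraction_conv a h.+1 (M - h))
  else Sfraction_conv a 1 M.

Lemma descents0 a M h : descents a M h 0%N = 1.
Proof.
elim: h => [|h IHh] /=; first exact: Sfraction_conv0.
by rewrite /fps_mul big_ord1 IHh mul1r Sfraction_conv0.
Qed.

(** Expanding the last factor by [Sfraction_conv_rec] amounts to splitting off the first step of the
    path, up or down. The bound on [h] gives that factor positive depth. *)
Lemma descents_rec a M h n : (h < M)%N ->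
  descents a M h n.+1 =
    a h.+1 * descents a M h.+1 n + if h is h'.+1 then descents a M h' n.+1 else 0.
Proof.
case: h => [|h] ltM.
  case: M ltM => // M _; rewrite [LHS]Sfraction_conv_rec addr0 add0r.
  by rewrite -(fps_mulA _ _ _ _) fps_ct_mul fps_mulC /= subSS subn0.
have defM := subnSK ltM; set m := (M - h.+2)%N in defM.
have -> : descents a M h.+1 n.+1 =
    fps_mul (descents a M h) (Sfraction_conv a h.+2 m.+1) n.+1 by rewrite defM.
rewrite (eq_fps_mul (frefl _) (@Sfraction_conv_rec a h.+2 m)).
set E := descents a M h; set F := Sfraction_conv a h.+2 m.+1.
set F' := Sfraction_conv a h.+3 m.
transitivity (fps_mul E (fps1 R) n.+1 +
              fps_mul E (fps_mul (fps_mul (fps_ct (a h.+2)) F') F) n.+1).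
  by rewrite /fps_mul -big_split; apply: eq_bigr => i _; rewrite /= -mulrDr.
rewrite fps_mul1 addrC; congr (_ + _).
rewrite (fps_mulC E) -(fps_mulA _ _ _ n.+1) -(fps_mulA _ _ _ n.+1).
rewrite fps_ct_mul; congr (_ * _); rewrite (fps_mulC F').
rewrite (eq_fps_mul (fps_mulC _ _) (frefl _)) /=.
by rewrite -/m -defM.
Qed.

(* Paths of length [m] from height [h] to 0; a step between the heights [k - 1]
   and [k] has weight [Y k] upwards and [X k] downwards. *)
Fixpoint path_sum X Y m h : R :=
  if m is m'.+1 then
    Y h.+1 * path_sum X Y m' h.+1
    + if h is h'.+1 then X h * path_sum X Y m' h' else 0
  else (h == 0%N)%:R.

Lemma path_sum_short X Y m h : (m < h)%N -> path_sum X Y m h = 0.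
Proof.
elim: m h => [|m IHm] [|h] //= ltmh.
by rewrite !IHm ?mulr0 ?addr0 // ltnW // ltnW.
Qed.

(** Both sides satisfy the same first-step recurrence; the product pays for the unmatched down
    steps. A path of this length stays at height at most h + n, so the bound [M] excludes none. *)
Lemma path_sum_descents a X Y M n h :
  (forall k, (0 < k)%N -> a k = X k * Y k) -> (h + n <= M)%N ->
  path_sum X Y (n.*2 + h) h = (\prod_(k < h) X k.+1) * descents a M h n.
Proof.
move=> aE; elim: n h => [|n IHn] h leM.
  rewrite descents0 mulr1; elim: h {leM} => [|h IHh]; first by rewrite big_ord0.
  by rewrite /= path_sum_short // mulr0 add0r IHh big_ord_recr mulrC.
have stepE k : (n.+1.*2 + k = (n.*2 + k.+1).+1)%N by rewrite doubleS !addSn addnS.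
elim: h leM => [|h IHh] leM; rewrite descents_rec ?stepE /=;
    try by rewrite (leq_trans _ leM) // -addn1 leq_add2l.
  by rewrite addr0 IHn ?add1n // big_ord_recl !big_ord0 !addr0 !mulr1 mul1r aE // mulrCA mulrA.
rewrite IHn; last by rewrite addSnnS.
rewrite (addnS _ h.+1) -stepE IHh; last by rewrite ltnW.
rewrite !big_ord_recr /= mulrDr aE //.
congr (_ + _).
  by rewrite mulrA (mulrC (Y _)) -!mulrA; congr (_ * (_ * _)).
by rewrite mulrA (mulrC (X _)).
Qed.

End FPSTheory.

(** * Sequential choices *)

Section Choices.
Variables (R : comNzRingType) (I T : finType) (w : I -> seq T -> T -> R).
Implicit Types (o : seq I) (t : seq T) (c : I -> R).

(* Weight of the choice of [t] for the indices [o].  Both lists are in reverse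
   order: the index [i] chooses [x] knowing the choices [t'] made before. *)
Fixpoint choice_weight o t : R :=
  match o, t with
  | i :: o', x :: t' => w i t' x * choice_weight o' t'
  | _, _ => 1
  end.

(** The head of the list is chosen last, so summing over it first splits off [c i]. Partial choices
    of weight 0 add nothing, so the hypothesis can be restricted to the others. *)
Lemma choice_weight_sum c o :
  (forall o1 i o2 t, o = o1 ++ i :: o2 -> size t = size o2 ->
     choice_weight o2 t != 0 -> \sum_x w i t x = c i) ->
  \sum_(t : (size o).-tuple T) choice_weight o t = \prod_(i <- o) c i.
Proof.
elim: o => [|i o IHo] wE.
  rewrite big_nil (big_pred1 [tuple]) => [|t] //=.
  by apply/esym/eqP/val_inj; case: t => [[]].
rewrite big_cons -IHo => [|o1 j o2 t def_o]; last by apply: (wE (i :: o1)); rewrite def_o.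
pose f (p : T * (size o).-tuple T) : (size o).+1.-tuple T := cons_tuple p.1 p.2.
pose g (t : (size o).+1.-tuple T) := (thead t, [tuple of behead t]).
rewrite (reindex f) /=; last first.
  exists g; last by move=> t _; rewrite [RHS]tuple_eta; apply: val_inj.
  by case=> x t _; congr (_, _); apply: val_inj.
rewrite -(pair_bigA _ (fun x (t : (size o).-tuple T) => w i t x * choice_weight o t)) /=.
rewrite exchange_big mulr_sumr; apply: eq_bigr => t _; rewrite -mulr_suml.
have [->|nz] := eqVneq (choice_weight o t) 0; first by rewrite !mulr0.
by rewrite (wE [::] i o) // size_tuple.
Qed.

Lemma choice_weight_zip o t i x : choice_weight o t != 0 ->
  (i, x) \in zip o t -> exists t', w i t' x != 0.
Proof.
elim: o t => [|j o IHo] [|y t] //=.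
move=> nz; rewrite inE => /predU1P[[-> ->]|zix].
  by exists t; apply: contraNneq nz => ->; rewrite mul0r.
by apply: IHo zix; apply: contraNneq nz => ->; rewrite mulr0.
Qed.

Lemma choice_weight_map (s : I -> T) (u : I -> R) o :
  (forall o1 i o2, o = o1 ++ i :: o2 -> w i (map s o2) (s i) = u i) ->
  choice_weight o (map s o) = \prod_(i <- o) u i.
Proof.
elim: o => [|i o IHo] wE; first by rewrite big_nil.
rewrite big_cons /= (wE [::]) // IHo // => o1 j o2 def_o.
by apply: (wE (i :: o1)); rewrite def_o.
Qed.

End Choices.

(** Only tuples without repetition have nonzero weight, and such a tuple, indexed by an enumeration
    of [I], lists the values of a permutation. *)
Lemma choice_weight_perm (R : comNzRingType) (I : finType)
    (w : I -> seq I -> I -> R) (o : seq I) :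
  uniq o -> (forall i, i \in o) ->
  (forall i t x, w i t x != 0 -> x \notin t) ->
  \sum_(t : (size o).-tuple I) choice_weight w o t =
  \sum_(s : {perm I}) choice_weight w o (map s o).
Proof.
move=> Uo oI wU.
have wU_uniq q t : size t = size q -> choice_weight w q t != 0 -> uniq t.
  elim: q t => [|i q IHq] [|x t] //= [szt] nz.
  rewrite (wU i); last by apply: contraNneq nz => ->; rewrite mul0r.
  by apply: IHq => //; apply: contraNneq nz => ->; rewrite mulr0.
pose f (s : {perm I}) := map_tuple s (in_tuple o).
have f_inj : injective f.
  move=> s1 s2 /(congr1 val) /= /eq_in_map Es; apply/permP => i.
  exact/Es/oI.
rewrite (bigID (mem (f @: [set: {perm I}]))) /= [X in _ + X]big1 ?addr0.
  rewrite big_imset; last by move=> s1 s2 _ _; apply: f_inj.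
  by apply: eq_bigl => s; rewrite inE.
move=> t; apply: contraNeq => nz.
have Ut := wU_uniq _ _ (size_tuple t) nz.
(* A nonempty [o] provides the default value for [nth]. *)
case: o Uo oI t nz Ut {wU_uniq} @f f_inj => [|i0 o'] Uo oI t nz Ut f f_inj.
  apply/imsetP; exists 1%g; rewrite ?inE //; apply: val_inj => /=.
  by case: t {nz Ut} => [[]].
pose o := i0 :: o'; pose h i := nth i0 t (index i o).
have h_inj : injective h.
  move=> i j /eqP; rewrite nth_uniq ?size_tuple ?index_mem ?oI // => /eqP E.
  by rewrite -(nth_index i0 (oI i)) E nth_index.
apply/imsetP; exists (perm h_inj); rewrite ?inE //; apply/val_inj/(@eq_from_nth _ i0).
  by rewrite /= size_map size_tuple.
move=> k; rewrite size_tuple => ltk.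
by rewrite (nth_map i0) // permE /h index_uniq.
Qed.

(** Injectivity makes the minimiser unique. *)
Lemma sum_argmin (R : pzRingType) (T : finType) (r : T -> nat) (C : {set T}) (a b : R) :
  injective r ->
  \sum_(x in C) (if [forall y in C, r x <= r y]%N then a else b) =
  if #|C| is m.+1 then a + b *+ m else 0.
Proof.
move=> r_inj; have [->|[x0 Cx0]] := set_0Vmem C; first by rewrite big_set0 cards0.
have [x xC minx] := arg_minnP r Cx0; have Cx : x \in C := xC.
rewrite (cardsD1 x) Cx (big_setD1 x) //=; congr (_ + _).
  by case: ifP => // /negP[]; apply/forall_inP.
rewrite -sumr_const; apply: eq_bigr => y /setD1P[neyx Cy]; case: ifP => // /forall_inP miny.
by case/eqP: neyx; apply: r_inj; apply/eqP; rewrite eqn_leq minx ?miny.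
Qed.

(** * Permutations with given cycle valleys *)

Lemma pairwise_rev (T : Type) (r : rel T) q :
  pairwise r (rev q) = pairwise (fun x y => r y x) q.
Proof. by elim: q => // x q IHq; rewrite rev_cons pairwise_rcons all_rev IHq. Qed.

Section ValleyWord.
Variables (R : comNzRingType) (N : nat) (V : 'I_N -> bool).
Variables (A B : bool -> nat -> R).
Implicit Types (i j x y : 'I_N) (s : {perm 'I_N}) (t : seq 'I_N).

(* The side of [i] on which its image has to lie. *)
Definition side i y := if V i then (i < y)%N else (y < i)%N.

(* [i] comes after [j] in the order in which images are chosen: first the peaks
   increasingly, then the valleys decreasingly. *)
Definition later i j := if V j == V i then side i j else V i.

(* Listed backwards, as required by [choice_weight]. *)
Definition choice_order : seq 'I_N :=
  [seq i <- enum 'I_N | V i] ++ rev [seq i <- enum 'I_N | ~~ V i].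

Definition candidates i t := [set y | [&& V y != V i, side i y & y \notin t]].

(** Smallest at the value that will make a valley a record or a peak an antirecord. *)
Definition distance i y : nat := if V i then (N - y)%N else y.

(* Vanishes on repeated values, so that summing over all tuples amounts to
   summing over permutations. *)
Definition choice i t x : R :=
  if x \in candidates i t then
    if [forall y in candidates i t, distance i x <= distance i y]%N
    then A (V i) i else B (V i) i
  else 0.

(** The indices subtracted are those of the kind of [i] chosen before it; each has used up one
    value. *)
Definition height i :=
  (#|[set y | (V y != V i) && side i y]| - #|[set y | (V y == V i) && side i y]|)%N.

Definition cost i : R := if height i is m.+1 then A (V i) i + B (V i) i *+ m else 0.

Definition alternates s := [forall i, (V (s i) != V i) && side i (s i)].

Lemma choice_order_uniq : uniq choice_order.
Proof.
rewrite cat_uniq rev_uniq !(filter_uniq _ (enum_uniq _)) /= andbT.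
by apply/hasPn => i; rewrite mem_rev !mem_filter => /andP[/negbTE->].
Qed.

Lemma mem_filter_enum (P : pred 'I_N) i : (i \in [seq j <- enum 'I_N | P j]) = P i.
Proof. by rewrite mem_filter mem_enum andbT. Qed.

Lemma mem_choice_order i : i \in choice_order.
Proof. by rewrite mem_cat mem_rev !mem_filter_enum orbN. Qed.

Lemma later_irr i : later i i = false.
Proof. by rewrite /later eqxx /side ltnn if_same. Qed.

Lemma later_asym i j : later i j -> later j i = false.
Proof.
rewrite /later /side eq_sym; case: (V i) (V j) => [] [] //=.
  by case: ltngtP.
by case: ltngtP.
Qed.

Lemma pairwise_choice_order : pairwise later choice_order.
Proof.
have ltn_enum : pairwise (fun i j => i < j)%N (enum 'I_N).
  rewrite -[pairwise _ _](pairwise_map val ltn) val_enum_ord.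
  by rewrite -sorted_pairwise ?iota_ltn_sorted //; apply: ltn_trans.
rewrite pairwise_cat; apply/and3P; split.
- apply/allrelP => i j; rewrite mem_rev !mem_filter_enum => Vi Vj.
  by rewrite /later Vi (negbTE Vj).
- apply: (@sub_in_pairwise _ V) (filter_all _ _) (pairwise_filter _ ltn_enum) => i j.
  by rewrite /later /side /in_mem /= => -> ->.
- rewrite pairwise_rev.
  apply: (@sub_in_pairwise _ (predC V)) (filter_all _ _) (pairwise_filter _ ltn_enum).
  by move=> i j; rewrite /later /side /in_mem /= => /negbTE-> /negbTE->.
Qed.

(** The list is sorted by the asymmetric relation [later], so its positions can be traded for that
    relation. *)
Lemma choice_order_suffix o1 i o2 j :
  choice_order = o1 ++ i :: o2 -> (j \in o2) = later i j.
Proof.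
move=> def_o; have := pairwise_choice_order; have := mem_choice_order j.
rewrite def_o pairwise_cat mem_cat inE /= => jo.
case/and3P=> /allrelP o1P _ /andP[/allP o2P _].
apply/idP/idP=> [/o2P //|ij]; case/or3P: jo => // [jo1|/eqP ji].
  by have := o1P j i jo1 (mem_head _ _); rewrite [later j i]later_asym.
by rewrite ji later_irr in ij.
Qed.

Lemma eq_choice i t1 t2 x : t1 =i t2 -> choice i t1 x = choice i t2 x.
Proof.
move=> et; suff eC : candidates i t1 = candidates i t2 by rewrite /choice eC.
by apply/setP=> y; rewrite !inE et.
Qed.

Lemma choice_neq0 i t x : choice i t x != 0 -> x \in candidates i t.
Proof. by rewrite /choice; case: ifP; rewrite ?eqxx. Qed.

Lemma distance_inj i : injective (distance i).
Proof.
move=> x y; rewrite /distance; case: ifP => _ E; apply: val_inj => //=.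
by rewrite -[LHS](@subKn _ N) 1?ltnW // E subKn // ltnW.
Qed.

(* The previous indices of the same kind as [i] (valley or peak) have all taken
   values that would otherwise be candidates for [i]. *)
Lemma card_candidates o1 i o2 t :
  choice_order = o1 ++ i :: o2 -> size t = size o2 ->
  choice_weight choice o2 t != 0 -> #|candidates i t| = height i.
Proof.
move=> def_o szt nz; have memo2 j := choice_order_suffix j def_o.
have Uo2 : uniq o2.
  by have := choice_order_uniq; rewrite def_o cat_uniq /= => /and3P[_ _ /andP[]].
have zipP j x : (j, x) \in zip o2 t -> (V x != V j) && side j x.
  by move=> /(choice_weight_zip nz)[t' /choice_neq0]; rewrite inE => /and3P[-> ->].
have Ut : uniq t.
  elim: o2 t szt nz {def_o memo2 Uo2 zipP} => [|j o IHo] [|y t] //= [szt] nz.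
  rewrite IHo //; last by apply: contraNneq nz => ->; rewrite mulr0.
  have /choice_neq0 : choice j t y != 0 by apply: contraNneq nz => ->; rewrite mul0r.
  by rewrite inE andbT => /and3P[].
pose D := [set y | (V y != V i) && side i y].
pose t' := [seq y <- t | V y != V i].
have szt' : size t' = #|[set y | (V y == V i) && side i y]|.
  (* Each index takes a value of the opposite kind, so the values in [t'] are counted by the earlier
     indices of the kind of [i]. *)
  rewrite size_filter; transitivity (count (fun j => V j == V i) o2).
    elim: o2 t szt zipP {def_o nz memo2 Uo2 Ut t'} => [|j o IHo] [|y t] //= [szt] zP.
    rewrite (IHo t) // => [|k x zkx]; last by apply: zP; rewrite inE zkx orbT.
    congr (_ + _)%N; have /andP[] := zP j y (mem_head _ _).
    by case: (V y) (V j) (V i) => [] [] [].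
  rewrite -size_filter -(card_uniqP _) ?filter_uniq //.
  apply: eq_card => j; rewrite !inE mem_filter memo2 /later.
  by case: eqP.
rewrite /height -szt' -(card_uniqP (filter_uniq _ Ut)) -/D.
have -> : candidates i t = D :\: [set y in t'].
  apply/setP=> y; rewrite !inE mem_filter.
  by case: (V y != V i); rewrite /= ?andbF // andbC.
(* The removed values all lie in [D]: an earlier index of the kind of [i] lies beyond [i], and its
   value lies beyond that index. *)
rewrite cardsD; congr (_ - _)%N; apply: eq_card => y; rewrite !inE mem_filter.
case nyi: (V y != V i) => //=; case ty: (y \in t); rewrite ?andbF // andbT.
have [k ltk def_y] : exists2 k, (k < size t)%N & y = nth i t k.
  by exists (index y t); rewrite ?index_mem ?nth_index.
have zk : (nth i o2 k, y) \in zip o2 t.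
  by rewrite def_y -nth_zip // mem_nth // size_zip szt minnn -szt.
have: later i (nth i o2 k) by have := memo2 (nth i o2 k); rewrite mem_nth -?szt // => <-.
have /andP[] := zipP _ _ zk; move: nyi; rewrite /later /side.
case: (V y) (V i) (V (nth i o2 k)) => [] [] [] //= _ _ l1 l2.
  exact: ltn_trans l1 l2.
exact: ltn_trans l2 l1.
Qed.

Lemma sum_choice_weight :
  \sum_(s : 'S_N) choice_weight choice choice_order (map s choice_order) =
  \prod_i cost i.
Proof.
rewrite -choice_weight_perm ?choice_order_uniq //; first last.
- by move=> i t x /choice_neq0; rewrite inE => /and3P[].
- exact: mem_choice_order.
rewrite (@choice_weight_sum _ _ _ _ cost) => [|o1 i o2 t def_o szt nz].
  rewrite big_uniq ?choice_order_uniq //=; apply: eq_bigl => i.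
  by rewrite mem_choice_order.
rewrite -big_mkcond /= sum_argmin ?(card_candidates def_o) //.
exact: distance_inj.
Qed.

(** For a valley [i], the candidates are the values above [i] of the valleys up to [i]. An index
    before [i] with value at most [i] cannot prevent a record, and one with value above [i] is a
    valley; so [s i] is the largest candidate exactly when [i] is a record. Peaks are symmetric. *)
Lemma choice_alternates s i t : alternates s ->
  (forall j, (s j \in t) = later i j) ->
  choice i t (s i) =
    if (if V i then is_record s i else antirecord s i) then A (V i) i else B (V i) i.
Proof.
move=> /forallP alt_s memt; have /andP[nVi side_i] := alt_s i.
rewrite /choice inE nVi side_i memt later_irr /=; congr (if _ then _ else _).
have candE j : (s j \in candidates i t) = [&& V j == V i, side i (s j) & ~~ side i j].
  rewrite inE memt /later; have /andP[+ +] := alt_s j; rewrite /side.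
  by case: (V i) (V j) (V (s j)) => [] [] []; rewrite ?andbF ?andbT.
have sjK j : s ((s^-1)%g j) = j by rewrite permKV.
move: (alt_s); case Vi: (V i) => {}alt_s.
  have lti : (i < s i)%N by move: side_i; rewrite /side Vi.
  apply/forall_inP/forallP => [minI j|recI y]; last first.
    rewrite -[y]sjK; set j := (s^-1)%g y; rewrite candE Vi /side Vi => /and3P[_ _].
    rewrite -leqNgt leq_eqVlt => /predU1P[/val_inj-> //|ltji].
    by rewrite /distance Vi leq_sub2l // ltnW // (implyP (recI j)).
  apply/implyP=> ltji; have /andP[nVj side_j] := alt_s j.
  have [ltis|] := ltnP i (s j); last by move=> le; apply: leq_ltn_trans lti.
  have /eqP Vj : V j == V i.
    move: side_j; rewrite /side Vi; case: (V j) => // ltsj.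
    by have := ltn_trans ltis ltsj; rewrite ltnNge ltnW.
  have := minI (s j); rewrite candE Vj eqxx /side Vi ltis -leqNgt ltnW // => /(_ isT).
  rewrite /distance Vi leq_sub2lE ?(ltnW (ltn_ord _)) // leq_eqVlt => /predU1P[|//].
  by move=> /val_inj/perm_inj E; rewrite E ltnn in ltji.
have lti : (s i < i)%N by move: side_i; rewrite /side Vi.
apply/forall_inP/forallP => [minI j|recI y]; last first.
  rewrite -[y]sjK; set j := (s^-1)%g y; rewrite candE Vi /side Vi => /and3P[_ _].
  rewrite -leqNgt leq_eqVlt => /predU1P[/val_inj-> //|ltji].
  by rewrite /distance Vi ltnW // (implyP (recI j)).
apply/implyP=> ltji; have /andP[nVj side_j] := alt_s j.
have [ltis|] := ltnP (s j) i; last by move=> le; apply: leq_trans le.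
have /eqP Vj : V j == V i.
  move: side_j; rewrite /side Vi; case: (V j) => // ltsj.
  by have := ltn_trans ltsj ltis; rewrite ltnNge ltnW.
have := minI (s j); rewrite candE Vj eqxx /side Vi ltis -leqNgt ltnW // => /(_ isT).
rewrite /distance Vi leq_eqVlt => /predU1P[|//].
by move=> /val_inj/perm_inj E; rewrite E ltnn in ltji.
Qed.

(** The sum extends to all permutations: one that does not alternate has a value that is no
    candidate, hence choice weight 0. *)
Lemma sum_alternates :
  \sum_(s : 'S_N | alternates s)
     \prod_i (if (if V i then is_record s i else antirecord s i)
              then A (V i) i else B (V i) i) = \prod_i cost i.
Proof.
rewrite -sum_choice_weight big_mkcond; apply: eq_bigr => s _.
(* As [choice] depends only on the set of values taken, the suffix of [choice_order] can be replaced
   by a list that depends on [i] alone. *)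
pose u i := choice i [seq s j | j <- enum (later i)] (s i).
have memu i j : (s j \in [seq s j | j <- enum (later i)]) = later i j.
  by rewrite mem_map ?mem_enum //; apply: perm_inj.
rewrite (@choice_weight_map _ _ _ _ _ u) => [|o1 i o2 def_o]; last first.
  apply: eq_choice => y; rewrite -[y](permKV s) memu mem_map; last exact: perm_inj.
  by rewrite (choice_order_suffix _ def_o).
have -> : \prod_(i <- choice_order) u i = \prod_i u i.
  rewrite big_uniq ?choice_order_uniq //; apply: eq_bigl => i.
  by rewrite mem_choice_order.
case: ifP => [alt_s|/forallPn[i nalt]].
  by apply: eq_bigr => i _; rewrite /u choice_alternates.
by rewrite (bigD1 i) //= {1}/u /choice inE memu later_irr andbT (negbTE nalt) mul0r.
Qed.

End ValleyWord.

(** * Words and heights *)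

Section Words.
Variable R : comNzRingType.

(* Weight of the path from height [h] whose up steps are the entries [true] of
   [b], or 0 if it does not end at height 0 or goes below it. *)
Fixpoint word_weight (X Y : nat -> R) h (b : seq bool) : R :=
  match b with
  | [::] => (h == 0%N)%:R
  | true :: b' => Y h.+1 * word_weight X Y h.+1 b'
  | false :: b' => if h is h'.+1 then X h * word_weight X Y h' b' else 0
  end.

Lemma sum_word_weight X Y m h :
  \sum_(b : m.-tuple bool) word_weight X Y h b = path_sum X Y m h.
Proof.
elim: m h => [|m IHm] h.
  rewrite (big_pred1 [tuple]) // => b.
  by apply/esym/eqP/val_inj; case: b => [[]].
pose f (p : bool * m.-tuple bool) : m.+1.-tuple bool := cons_tuple p.1 p.2.
pose g (b : m.+1.-tuple bool) := (thead b, [tuple of behead b]).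
rewrite (reindex f) /=; last first.
  exists g; last by move=> b _; rewrite [RHS]tuple_eta; apply: val_inj.
  by case=> v b _; congr (_, _); apply: val_inj.
rewrite -(pair_bigA _ (fun v (b : m.-tuple bool) => word_weight X Y h (v :: b))) /=.
rewrite big_bool /= -mulr_sumr IHm; congr (_ + _).
by case: h => [|h]; [rewrite big1 | rewrite -mulr_sumr IHm].
Qed.

Lemma word_weight_balanced X Y h b :
  word_weight X Y h b != 0 -> (h + count id b = count negb b)%N.
Proof.
elim: b h => [|[] b IHb] [|h] //=; rewrite ?eqxx // => nz.
- by rewrite addnA addn1 add0n IHb //; apply: contraNneq nz => ->; rewrite mulr0.
- by rewrite addnA addn1 IHb //; apply: contraNneq nz => ->; rewrite mulr0.
- by rewrite add0n addSn IHb //; apply: contraNneq nz => ->; rewrite mulr0.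
Qed.

(** Total weight of [k] options, one of weight [a] and the rest of weight [b]. *)
Definition ladder (a b : R) k := if k is m.+1 then a + b *+ m else 0.

(* The height of the path next to step [i]: it is read from the left for a down
   step and from the right for an up step. *)
Definition step_height h (b : seq bool) i :=
  if nth false b i then (count negb (drop i.+1 b) - count id (drop i.+1 b))%N
  else (h + count id (take i b) - count negb (take i b))%N.

(** Before step [i] the height has the parity of h + i. A down step of height [k] starts at [k] and
    an up step at k - 1, whence the negation. Balance makes the reading from the right give the
    height after an up step. *)
Lemma prod_ladder (a c : bool -> bool -> R) h b :
  (h + count id b = count negb b)%N ->
  \prod_(i < size b)
     ladder (a (nth false b i) (odd (h + i))) (c (nth false b i) (odd (h + i)))
            (step_height h b i) =
  word_weight (fun k => ladder (a false (odd k)) (c false (odd k)) k)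
              (fun k => ladder (a true (~~ odd k)) (c true (~~ odd k)) k) h b.
Proof.
elim: b h => [|[] b IHb] h /=.
- by rewrite addn0 => ->; rewrite big_ord0.
- rewrite add0n add1n addnS -addSn => bal.
  rewrite big_ord_recl /= -IHb //; congr (_ * _).
    by rewrite addn0 negbK /step_height /= drop0 -bal addnK.
  by apply: eq_bigr => i _; rewrite /step_height /= /bump /= !add0n !add1n !addnS addSn.
rewrite big_ord_recl /= add0n add1n => bal.
(* A down step from height 0 has step height 0, where [ladder] vanishes. *)
case: h bal => [|h] bal; first by rewrite /step_height /= mul0r.
rewrite -IHb; last by case: bal.
congr (_ * _); first by rewrite /step_height [take _ _]/= !addn0.
apply: eq_bigr => i _; rewrite /step_height /= /bump /= !add0n !add1n !addnS !addSn.
by rewrite subSS /= negbK.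
Qed.

End Words.

Lemma count_take (P : pred bool) b i :
  count (fun j => P (nth false b j) && (j < i))%N (iota 0 (size b)) = count P (take i b).
Proof.
elim: b i => [|v b IHb] [|i] //=.
  by rewrite andbF; apply/eqP; rewrite eqn0Ngt -has_count; apply/hasPn => j; rewrite andbF.
by rewrite andbT (iotaDl 1 0) count_map -IHb; congr (_ + _)%N; apply: eq_count.
Qed.

Lemma count_drop (P : pred bool) b i :
  count (fun j => P (nth false b j) && (i <= j))%N (iota 0 (size b)) = count P (drop i b).
Proof.
elim: b i => [|v b IHb] [|i] //=.
  rewrite andbT (iotaDl 1 0) count_map -[in RHS](drop0 b) -IHb; congr (_ + _)%N.
by rewrite andbF (iotaDl 1 0) count_map -IHb; apply: eq_count.
Qed.

Lemma card_ord N (P : pred nat) : #|[set i : 'I_N | P i]| = count P (iota 0 N).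
Proof. by rewrite cardsE cardE -val_enum_ord count_map -size_filter enumT. Qed.

Lemma height_word N (b : N.-tuple bool) i : height (tnth b) i = step_height 0 b i.
Proof.
rewrite /height /step_height /side (tnth_nth false).
have cardE (P Q : pred nat) : #|[set y : 'I_N | P y && Q y]| =
    count (fun j => P j && Q j) (iota 0 (size b)).
  by rewrite (@card_ord N (fun j => P j && Q j)) size_tuple.
rewrite -!count_take -!count_drop -!cardE; case: ifP => _; congr (_ - _)%N.
all: by apply: eq_card => y; rewrite !inE !(tnth_nth false); case: (nth _ _ y).
Qed.

(** * Cycle-alternating permutations and their valley words *)

Section Alternating.
Variable N : nat.
Implicit Types (s : 'S_N) (i : 'I_N).

(** The preimage and the image of [i] both have the kind opposite to [i], so they lie on the same
    side of it. *)
Lemma alternatesE (V : 'I_N -> bool) s :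
  alternates V s = cycle_alternating s && [forall i, V i == cycle_valley s i].
Proof.
apply/forallP/andP=> [alt_s|[/forallP ca_s /forallP defV] i].
  suff ca i : [&& ~~ cycle_double_rise s i, ~~ cycle_double_fall s i, ~~ fixed_point s i
                & V i == cycle_valley s i].
    by split; apply/forallP => i; have /and4P[? ? ? ?] := ca i; first apply/and3P.
  rewrite /cycle_double_rise /cycle_double_fall /fixed_point /cycle_valley -val_eqE /=.
  have /andP[] := alt_s i; have /andP[] := alt_s (s^-1%g i); rewrite permKV /side.
  case: (V i) (V (s i)) (V (s^-1%g i)) => [] [] [] //= _ l1 _ l2.
    by rewrite l1 l2 (ltnNge _ i) (ltnW l1) (gtn_eqF l2) (ltnNge (s i)) (ltnW l2).
  by rewrite !(ltnNge i) (ltnW l1) (ltnW l2) l1 (ltn_eqF l2).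
have caE j : cycle_valley s j = (j < s j)%N /\ cycle_valley s j = (j < s^-1%g j)%N.
  have /and3P[] := ca_s j.
  rewrite /cycle_double_rise /cycle_double_fall /fixed_point /cycle_valley.
  have : (s^-1%g j == j) = (s j == j).
    by rewrite -(inj_eq (@perm_inj _ s)) permKV eq_sym.
  by rewrite -!val_eqE /=; case: (ltngtP (s^-1%g j) j) => ?; case: (ltngtP (s j) j) => ? //=.
rewrite !(eqP (defV _)) (caE i).1 (caE (s i)).2 permK /side (eqP (defV i)) (caE i).1.
have /and3P[_ _] := ca_s i; rewrite /fixed_point -val_eqE /=.
by case: ltngtP.
Qed.

(** The permutation injects valleys into peaks and peaks into valleys. *)
Lemma alternates_balanced (b : N.-tuple bool) s :
  alternates (tnth b) s -> count id b = count negb b.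
Proof.
move=> /forallP alt_s.
have cardV (P : pred bool) : count P b = #|[set i | P (tnth b i)]|.
  rewrite -{1}(drop0 b) -count_drop size_tuple -card_ord.
  by apply: eq_card => i; rewrite !inE andbT (tnth_nth false).
have le (P Q : pred bool) : (forall i, P (tnth b i) -> Q (tnth b (s i))) ->
    (count P b <= count Q b)%N.
  move=> PQ; rewrite !cardV -(card_imset _ (@perm_inj _ s)) subset_leq_card //.
  by apply/subsetP => _ /imsetP[i + ->]; rewrite !inE; apply: PQ.
by apply/eqP; rewrite eqn_leq !le // => i;
  have /andP[+ _] := alt_s i; case: (tnth b i) (tnth b (s i)) => [] [].
Qed.

Variables (R : comNzRingType) (a c : bool -> bool -> R).

Definition index_weight s i : R :=
  if (if cycle_valley s i then is_record s i else antirecord s i)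
  then a (cycle_valley s i) (odd i) else c (cycle_valley s i) (odd i).

Lemma sum_index_weight :
  \sum_(s : 'S_N | cycle_alternating s) \prod_i index_weight s i =
  path_sum (fun k => ladder (a false (odd k)) (c false (odd k)) k)
           (fun k => ladder (a true (~~ odd k)) (c true (~~ odd k)) k) N 0.
Proof.
rewrite -sum_word_weight.
pose word s := [tuple cycle_valley s i | i < N].
rewrite (partition_big word xpredT) //=; apply: eq_bigr => b _.
have altE s : cycle_alternating s && (word s == b) = alternates (tnth b) s.
  rewrite alternatesE; congr (_ && _); apply/eqP/forallP => [<- i|E].
    by rewrite tnth_mktuple.
  by apply: eq_from_tnth => i; rewrite tnth_mktuple (eqP (E i)).
(* For an unbalanced word both sides are 0; [prod_ladder] treats the balanced ones. *)
rewrite (eq_bigl _ _ altE); have [bal|] := eqVneq (count id b) (count negb b); last first.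
  move=> nbal; rewrite big_pred0 => [|s].
    by apply/esym/eqP; apply: contraNT nbal => /word_weight_balanced <-.
  by apply: contraNF nbal => /alternates_balanced ->.
rewrite -prod_ladder // size_tuple.
pose A v (i : nat) := a v (odd i); pose C v (i : nat) := c v (odd i).
transitivity (\prod_i cost (tnth b) A C i).
  rewrite -sum_alternates; apply: eq_bigr => s.
  rewrite alternatesE => /andP[_ /forallP defV]; apply: eq_bigr => i _.
  by rewrite /index_weight !(eqP (defV i)).
by apply: eq_bigr => i _; rewrite /cost height_word (tnth_nth false).
Qed.

End Alternating.

(** * The eight statistics and the continued fraction *)

Lemma expr_card (R : comNzRingType) (T : finType) (x : R) (P : pred T) :
  x ^+ #|[set i | P i]| = \prod_i (if P i then x else 1).
Proof. by rewrite -big_mkcond prodr_const cardsE. Qed.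

(** The flag [p] is the parity of the ordinal [i], which stands for i + 1, so a true [p] selects the
    even variables. *)
Lemma prod_index_weight N (R : comNzRingType) (xe ye ue ve xo yo uo vo : R) (s : 'S_N) :
  cycle_alternating s ->
  xe ^+ eareccpeakeven s * ye ^+ ereccvaleven s
    * ue ^+ nrcpeakeven s * ve ^+ nrcvaleven s
    * xo ^+ eareccpeakodd s * yo ^+ ereccvalodd s
    * uo ^+ nrcpeakodd s * vo ^+ nrcvalodd s =
  \prod_i index_weight
    (fun v p => if v then if p then ye else yo else if p then xe else xo)
    (fun v p => if v then if p then ve else vo else if p then ue else uo) s i.
Proof.
move=> /forallP ca_s; rewrite !expr_card -!big_split; apply: eq_bigr => i _ /=.
rewrite /index_weight /exclusive_antirecord /exclusive_record /neither_record_antirecord.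
rewrite /even_index /odd_index /= negbK.
(* The position of the value [i] shows that a valley [i] is no antirecord and a
   peak [i] no record. *)
have val_narec : cycle_valley s i -> antirecord s i = false.
  case/andP=> lt1 lt2; apply/negbTE/forallPn; exists (s^-1%g i).
  by rewrite permKV lt1 -leqNgt ltnW.
have peak_nrec : cycle_peak s i -> is_record s i = false.
  case/andP=> lt1 lt2; apply/negbTE/forallPn; exists (s^-1%g i).
  by rewrite permKV lt1 -leqNgt ltnW.
have : cycle_peak s i = ~~ cycle_valley s i.
  have /and3P[] := ca_s i.
  rewrite /cycle_double_rise /cycle_double_fall /fixed_point /cycle_valley /cycle_peak.
  have : (s^-1%g i == i) = (s i == i) by rewrite -(inj_eq (@perm_inj _ s)) permKV eq_sym.
  by rewrite -!val_eqE /=; case: (ltngtP (s^-1%g i) i) => ?; case: (ltngtP (s i) i) => ? //=.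
case: (cycle_valley s i) val_narec peak_nrec => /= narec nrec peakE; rewrite peakE in nrec *.
  by rewrite narec //; case: (odd i); case: is_record; rewrite /= ?(mul1r, mulr1).
by rewrite nrec //; case: (odd i); case: antirecord; rewrite /= ?(mul1r, mulr1).
Qed.

Theorem theorem4p1 (alpha : nat -> polyring)
    (alpha_odd : forall k : nat, (1 <= k)%N ->
       alpha (2 * k - 1)%N =
         (x_e + u_e *+ (2 * k - 2)) * (y_o + v_o *+ (2 * k - 2)))
    (alpha_even : forall k : nat, (1 <= k)%N ->
       alpha (2 * k)%N =
         (x_o + u_o *+ (2 * k - 1)) * (y_e + v_e *+ (2 * k - 1))) :
  Sfraction_eq Q alpha.
Proof.
(* A path of length 2n never rises above height n, so depth n suffices for this coefficient. *)
move=> n; exists n => m lenm.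
pose a v p : polyring := if v then if p then y_e else y_o else if p then x_e else x_o.
pose c v p : polyring := if v then if p then v_e else v_o else if p then u_e else u_o.
pose X k := ladder (a false (odd k)) (c false (odd k)) k.
pose Y k := ladder (a true (~~ odd k)) (c true (~~ odd k)) k.
have alphaE k : (0 < k)%N -> alpha k = X k * Y k.
  case: k => // k _; rewrite /X /Y /ladder /= negbK.
  (* Here [k] is one less than the index of [alpha], so an odd [k] calls for [alpha_even]. *)
  have defk := odd_double_half k; rewrite /a /c; case: (odd k) defk => defk.
    have := alpha_even k./2.+1 isT; rewrite mul2n doubleS subn1 /=.
    by rewrite -[_.*2.+1]/(true + _)%N defk => ->.
  have := alpha_odd k./2.+1 isT; rewrite mul2n doubleS subn1 subn2 /=.
  by rewrite -[_.*2]/(false + _)%N defk => ->.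
have := path_sum_descents alphaE (leq_trans (eq_leq (add0n n)) lenm).
rewrite big_ord0 mul1r addn0 /= => <-; rewrite -mul2n -sum_index_weight /Q.
by apply: eq_bigr => s ca_s; rewrite -prod_index_weight.
Qed.
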